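(* Let $G$ be a finite group and let $\mathcal{F}$ be an injective group cellular automaton on $G$. If $\mathcal{F}$ is expansive, then $\mathcal{F}$ is topologically transitive.
   Context: For a finite group $G$, $G^{\mathbb{Z}}$ is a group under the componentwise operation, with the product topology of the discrete topologies on the factors; this topology is induced by the metric $d(c,c')=0$ if $c=c'$ and $d(c,c')=2^{-\min\{|j|:\ c_j\neq c'_j\}}$ otherwise. A group cellular automaton (GCA) on $G$ is a continuous group endomorphism $\mathcal{F}:G^{\mathbb{Z}}\to G^{\mathbb{Z}}$ commuting with the shift $\sigma$, $\sigma(c)_i=c_{i+1}$. An injective GCA is bijective and its inverse is again a GCA. An injective GCA $\mathcal{F}$ is expansive if there is $\epsilon>0$ such that for any two distinct $c,c'\in G^{\mathbb{Z}}$ there is $n\in\mathbb{Z}$ with $d(\mathcal{F}^n(c),\mathcal{F}^n(c'))>\epsilon$. A GCA $\mathcal{F}$ is topologically transitive if for any nonempty open $U,V\subseteq G^{\mathbb{Z}}$ there is $n\in\mathbb{N}$ with $\mathcal{F}^n(U)\cap V\ne\emptyset$. *)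

(* Defs.v *)
From HB Require Import structures.
From mathcomp Require Import all_boot all_order all_algebra all_fingroup.
From mathcomp Require Import all_classical all_reals all_analysis.

Set Implicit Arguments.
Unset Strict Implicit.
Unset Printing Implicit Defensive.

Import Order.TTheory GRing.Theory Num.Theory.
Local Open Scope classical_set_scope.
Local Open Scope ring_scope.

Definition config (G : finGroupType) : Type :=
  prod_topology (fun _ : int => discrete_topology G).

HB.instance Definition _ (G : finGroupType) := Choice.on (config G).
HB.instance Definition _ (G : finGroupType) := Nbhs.on (config G).
HB.instance Definition _ (G : finGroupType) := Topological.on (config G).

Section ConfigGroup.
Variable G : finGroupType.
Implicit Types c : config G.

Definition config_mul c c' : config G := fun i => ((c i : G) * (c' i : G))%g.
Definition config_one : config G := fun=> (1%g : G).
Definition config_inv c : config G := fun i => ((c i : G)^-1)%g.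

Lemma config_mulA : associative config_mul.
Proof. by move=> c c' c''; apply/funext => i; exact: mulgA. Qed.

Lemma config_mul1c : left_id config_one config_mul.
Proof. by move=> c; apply/funext => i; exact: mul1g. Qed.

Lemma config_mulc1 : right_id config_one config_mul.
Proof. by move=> c; apply/funext => i; exact: mulg1. Qed.

Lemma config_mulVc : left_inverse config_one config_inv config_mul.
Proof. by move=> c; apply/funext => i; exact: mulVg. Qed.

Lemma config_mulcV : right_inverse config_one config_inv config_mul.
Proof. by move=> c; apply/funext => i; exact: mulgV. Qed.

HB.instance Definition _ := hasMul.Build (config G) config_mul.
HB.instance Definition _ := hasOne.Build (config G) config_one.
HB.instance Definition _ := hasInv.Build (config G) config_inv.
HB.instance Definition _ := Magma_isSemigroup.Build (config G) config_mulA.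
HB.instance Definition _ :=
  BaseUMagma_isUMagma.Build (config G) config_mul1c config_mulc1.
HB.instance Definition _ :=
  Monoid_isGroup.Build (config G) config_mulVc config_mulcV.

End ConfigGroup.

Definition config_shift (G : finGroupType) (c : config G) : config G :=
  fun i => c (i + 1).

Record is_GCA (G : finGroupType) (F : config G -> config G) : Prop := {
  GCA_continuous : continuous F;
  GCA_morph : {morph F : c c' / (c * c')%g};
  GCA_shift : forall c, F (config_shift c) = config_shift (F c)
}.

Definition differ_at (G : finGroupType) (c c' : config G) (n : nat) : bool :=
  `[< exists2 j : int, `|j|%N = n & c j <> c' j >].

Lemma differ_at_exists (G : finGroupType) (c c' : config G) :
  c <> c' -> exists n, differ_at c c' n.
Proof.
move=> neq; apply: contrapT => H; apply: neq; apply/funext => j.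
by apply: contrapT => cj; apply: H; exists `|j|%N; apply/asboolP; exists j.
Qed.

Definition config_dist (R : realType) (G : finGroupType) (c c' : config G) : R :=
  match pselect (c = c') with
  | left _ => 0
  | right neq => 2 ^- ex_minn (differ_at_exists neq)
  end.

(* pinv is a genuine two-sided inverse here because an injective GCA is
   bijective; Negz m is the integer -(m + 1). *)
Definition iterz (G : finGroupType) (F : config G -> config G) (n : int) :
    config G -> config G :=
  match n with
  | Posz m => iter m F
  | Negz m => iter m.+1 ('pinv_id [set: config G] F)
  end.

Definition expansive (R : realType) (G : finGroupType)
    (F : config G -> config G) : Prop :=
  exists2 eps : R, 0 < eps & forall c c' : config G, c <> c' ->
    exists n : int, eps < config_dist R (iterz F n c) (iterz F n c').

Definition topologically_transitive (T : topologicalType) (F : T -> T) : Prop :=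
  forall U V : set T, open U -> U !=set0 -> open V -> V !=set0 ->
    exists n : nat, (iter n F @` U) `&` V !=set0.

(* Main.v *)
(** Write [X] for the compact group [G^Z] and [U] for the cylinder subgroup that
    witnesses expansivity, so that only [1] has its whole orbit in [U].

    A compactness argument shows that the coding of [X] by itineraries
    modulo [U] is of finite type: if [F^-k x] lies in [U] for [0 < k <= n], then
    [x = y w] where the strict past of [y] and the future of [w] stay in [U].
    Expansivity makes the approach to [1] uniform on such sets, so [y] lies in
    the unstable group [Wu] and [w] in the stable group [Ws] of [1]. Hence
    [Wu Ws] contains a cylinder subgroup; being a normal subgroup invariant
    under the shift, it is all of [X].

    Let [L] be the local unstable group. Then [P = L Ws] is an open subgroup
    with [F^-1 P] in [P], and [X] is the increasing union of the [F^k P]; by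
    compactness [X = P]. Applying [F^-m], [X = F^-m(L) Ws] where [F^-m(L)]
    shrinks to [1], so [Ws] is dense, and so is [Wu] by symmetry. Given targets
    [p] and [q], choose [p'] in [Ws] near [p] and [q'] in [Wu] near [q]: the
    point [p' F^-n(q')] is near [p] and, for large [n], its [n]-th image is near
    [q]. *)
Require Import Defs.
From mathcomp Require Import all_boot all_order all_algebra all_fingroup.
From mathcomp Require Import all_classical all_reals all_analysis.
From mathcomp Require Import zify.

Set Implicit Arguments.
Unset Strict Implicit.
Unset Printing Implicit Defensive.

Import Order.TTheory GRing.Theory Num.Theory.
Local Open Scope classical_set_scope.
Local Open Scope group_scope.

(** * Cylinder subgroups and compactness *)

Section Cylinders.
Variable G : finGroupType.
Implicit Types (c d x y : config G) (M n : nat).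

Definition cyl M : set (config G) :=
  [set c | forall i : int, (`|i| <= M)%N -> c i = 1 :> G].

Lemma cylM M c d : cyl M c -> cyl M d -> cyl M (c * d).
Proof.
move=> Mc Md i iM; rewrite [LHS](_ : _ = (c i : G) * (d i : G))//.
by rewrite Mc// Md// mulg1.
Qed.

Lemma cylV M c : cyl M c -> cyl M c^-1.
Proof.
by move=> Mc i iM; rewrite [LHS](_ : _ = (c i : G)^-1)// Mc// invg1.
Qed.

Lemma cylJ M c d : cyl M c -> cyl M (c ^ d).
Proof.
move=> Mc i iM; rewrite [LHS](_ : _ = (d i : G)^-1 * ((c i : G) * (d i : G)))//.
by rewrite Mc// mul1g mulVg.
Qed.

Lemma cylS M n c : (M <= n)%N -> cyl n c -> cyl M c.
Proof. by move=> Mn nc i iM; apply: nc; exact: leq_trans Mn. Qed.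

Lemma cylP M c d :
  cyl M (c^-1 * d) <-> forall i : int, (`|i| <= M)%N -> c i = d i.
Proof.
split=> [cd i /cd|cd i iM].
  rewrite [X in X = _](_ : _ = (c i : G)^-1 * (d i : G))// => /mulg1_eq.
  by rewrite invgK.
by rewrite [LHS](_ : _ = (c i : G)^-1 * (d i : G))// cd// mulVg.
Qed.

Lemma cyl_eq1 c : (forall M, cyl M c) -> c = 1.
Proof. by move=> h; apply/funext => i; exact: (h `|i|%N). Qed.

Lemma nbhs_cyl c M : nbhs c [set d | cyl M (c^-1 * d)].
Proof.
have near1 (i : int) : nbhs c [set d : config G | c i = d i].
  pose K (_ : int) : topologicalType := discrete_topology G.
  have h : nbhs (c : config G) (@proj int K i @^-1` [set (c i : K i)]).
    exact: (@proj_continuous int K i c _ (discrete_set1 _)).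
  by apply: (@filterS _ _ _ _ _ _ h) => d /= /esym.
elim: M => [|M IH].
  apply: filterS (near1 0%R) => d cd; apply/cylP => i.
  by rewrite leqn0 absz_eq0 => /eqP ->.
apply: filterS (filterI IH (filterI (near1 (Posz M.+1)) (near1 (Negz M)))).
move=> d [/cylP cd [/= cd1 cd2]].
apply/cylP => i.
rewrite leq_eqVlt => /predU1P[|/cd//].
by case: i => j /=; [move=> -> | case=> ->].
Qed.

(** Otherwise points outside [A] agreeing with [c] on growing windows would converge to [c]
    coordinatewise. *)
Lemma cyl_nbhs c (A : set (config G)) :
  nbhs c A -> exists M, forall d, cyl M (c^-1 * d) -> A d.
Proof.
move=> cA; apply: contrapT => /forallNP nA.
have {nA} /choice[u uP] : forall M, exists d, cyl M (c^-1 * d) /\ ~ A d.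
  by move=> M; have /existsNP[d /not_implyP] := nA M; exists d.
suff : u @ \oo --> c.
  by move=> /(_ _ cA)[n _ /(_ n (leqnn n))]; exact: (uP n).2.
apply/cvg_sup => i B; pose ev (f : config G) : discrete_topology G := f i.
rewrite /= (@nbhsE (initial_topology ev)) => -[_ [[W _ <-] Wc] sWB].
exists `|i|%N => // k /= ik; apply: sWB; rewrite /= /ev.
by have /cylP/(_ i ik) <- := (uP k).1.
Qed.

(** Tychonoff's theorem for sequences, applied below to sequences of approximations or of
    counterexamples. *)
Lemma seq_adherent (u : nat -> config G) :
  exists x, forall M n, exists2 k, (n <= k)%N & cyl M (x^-1 * u k).
Proof.
have cpt := @tychonoff int (fun=> discrete_topology G) _
  (fun=> @finite_compact (discrete_topology G) setT (@finite_finset G setT)).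
have [|x [_ xu]] := cpt (u @ \oo) _; first by apply: filterS filterT.
exists (x : config G) => M n.
have un : (u @ \oo) [set u k | k in [set k | (n <= k)%N]].
  by exists n => // k nk; exists k.
by have [_ [[k nk <-] xk]] := xu _ _ un (nbhs_cyl (x : config G) M); exists k.
Qed.

End Cylinders.

(** * Continuity at 1 and passage to limits *)

Section GCATheory.
Variable G : finGroupType.
Implicit Types (c d x y : config G) (M n : nat) (F E : config G -> config G).

Lemma GCA1 F : is_GCA F -> F 1 = 1.
Proof. by case=> _ FM _; apply: (mulgI (F 1)); rewrite -FM !mulg1. Qed.

Lemma GCAV F x : is_GCA F -> F x^-1 = (F x)^-1.
Proof.
by move=> hF; apply: (mulgI (F x)); rewrite -(GCA_morph hF) !mulgV GCA1.
Qed.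

Lemma GCA_cyl F M :
  is_GCA F -> exists m, forall c, cyl m c -> cyl M (F c).
Proof.
move=> hF.
have /(GCA_continuous hF)/cyl_nbhs[m hm] := nbhs_cyl (F 1) M.
exists m => c mc; have := hm c.
by rewrite invg1 mul1g /= GCA1// invg1 mul1g; exact.
Qed.

Lemma cyl_GCA F :
  {morph F : c d / c * d} ->
  (forall c, F (config_shift c) = config_shift (F c)) ->
  (forall M, exists m, forall c, cyl m c -> cyl M (F c)) -> is_GCA F.
Proof.
move=> FM Fs Fcyl; split=> // c A /cyl_nbhs[M MA].
have [m hm] := Fcyl M; apply: filterS (nbhs_cyl c m) => d /hm cd; apply: MA.
have -> // : (F c)^-1 * F d = F (c^-1 * d).
by apply: (mulgI (F c)); rewrite -FM !mulVKg.
Qed.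

Lemma GCA_iter F n : is_GCA F -> is_GCA (iter n F).
Proof.
move=> hF; elim: n => [|n IH]; apply: cyl_GCA => //=.
- by move=> M; exists M.
- by move=> c d /=; rewrite (GCA_morph IH) (GCA_morph hF).
- by move=> c; rewrite (GCA_shift IH) (GCA_shift hF).
- move=> M; have [m hm] := GCA_cyl M hF; have [k hk] := GCA_cyl m IH.
  by exists k => c /hk /hm.
Qed.

(** Cylinders are closed and [E] is continuous, so a condition valid along the sequence from index
    [n] on survives at its adherent point. *)
Lemma adherent_cyl (u : nat -> config G) x E a M n :
  is_GCA E ->
  (forall M n, exists2 k, (n <= k)%N & cyl M (x^-1 * u k)) ->
  (forall k, (n <= k)%N -> cyl M (a * E (u k))) -> cyl M (a * E x).
Proof.
move=> hE xu aE; have [m hm] := GCA_cyl M hE; have [k nk /hm] := xu m n.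
rewrite (GCA_morph hE) (GCAV _ hE) => /cylV; rewrite invgM invgK => h.
by have := cylM (aE k nk) h; rewrite mulgA mulgK.
Qed.

Definition shiftz (k : int) c : config G := fun i => c (i + k)%R.

Lemma shiftzK k : cancel (shiftz k) (shiftz (- k)%R).
Proof. by move=> c; apply/funext => i; rewrite /shiftz subrK. Qed.

Lemma shiftzNK k : cancel (shiftz (- k)%R) (shiftz k).
Proof. by move=> c; apply/funext => i; rewrite /shiftz addrK. Qed.

Lemma shiftz0 c : shiftz 0%R c = c.
Proof. by apply/funext => i; rewrite /shiftz addr0. Qed.

Lemma shiftzD k l c : shiftz (k + l)%R c = shiftz k (shiftz l c).
Proof. by apply/funext => i; rewrite /shiftz addrA. Qed.

Lemma GCA_shiftz F k c : is_GCA F -> F (shiftz k c) = shiftz k (F c).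
Proof.
move=> hF.
have pos (n : nat) d : F (shiftz n%:Z%R d) = shiftz n%:Z%R (F d).
  elim: n d => [|n IH] d.
    by rewrite !shiftz0.
  by rewrite -addn1 PoszD !shiftzD IH; congr shiftz; exact: GCA_shift hF d.
case: (intP k) => [|n|n]; [exact: (pos 0)|exact: pos|].
by apply: (can_inj (shiftzK n.+1%:Z%R)); rewrite -pos !shiftzNK.
Qed.

End GCATheory.

(** * Periodic points and the inverse automaton *)

Section Inverse.
Variable G : finGroupType.
Implicit Types (c d x y : config G) (M n : nat) (F : config G -> config G).

Definition periodize n (f : {ffun 'I_n.*2.+1 -> G}) : config G :=
  fun i => f (inord `|((i + Posz n) %% (Posz n.*2.+1))%Z|%N).

Definition window n c : {ffun 'I_n.*2.+1 -> G} :=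
  [ffun k : 'I_n.*2.+1 => c (Posz k - Posz n)%R : G].

Lemma periodize_shift n (f : {ffun 'I_n.*2.+1 -> G}) :
  shiftz (Posz n.*2.+1) (periodize f) = periodize f :> config G.
Proof.
apply/funext => i; rewrite /shiftz /periodize; congr (f (inord `|_|%N)).
by rewrite addrAC modzDr.
Qed.

Lemma windowK n c : shiftz (Posz n.*2.+1) c = c -> periodize (window n c) = c.
Proof.
set p : int := (Posz n.*2.+1) => pc.
have pcn (k : int) d i : shiftz k d = d -> d (i + k)%R = d i.
  by move=> {2}<-.
have per (q : int) i : c (i + q * p)%R = c i.
  have posq (m : nat) j : c (j + Posz m * p)%R = c j.
    elim: m j => [|m IH] j; first by rewrite mul0r addr0.
    by rewrite -addn1 PoszD mulrDl mul1r addrA (pcn p).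
  case: (intP q) => [|m|m]; [exact: (posq 0)|exact: posq|].
  by rewrite -(posq m.+1) -addrA -mulrDl addNr mul0r addr0.
apply/funext => i; rewrite /periodize ffunE inordK; last by lia.
have qr := divz_eq (i + Posz n)%R p; set q := divz _ _ in qr.
have r0 : (0 <= modz (i + Posz n) p)%R by rewrite modz_ge0.
rewrite -(per (- q)%R i) mulNr; congr c.
move: qr r0; move: (q * p)%R (modz _ _) => s r; lia.
Qed.

Lemma periodizeK n : cancel (@periodize n) (@window n).
Proof.
move=> f; apply/ffunP => k; rewrite ffunE /periodize; congr (f _).
apply: val_inj.
by rewrite /= subrK modz_small ?inordK //; have := ltn_ord k; lia.
Qed.

Lemma periodize_window n c i : (`|i| <= n)%N -> periodize (window n c) i = c i.
Proof.
move=> ni; rewrite /periodize ffunE modz_small; last by lia.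
by rewrite inordK; [congr c|]; lia.
Qed.

(* [F] permutes each finite set of periodic points, and these are dense. *)
Lemma GCA_surj F : is_GCA F -> injective F -> forall x, exists y, F y = x.
Proof.
move=> hF Finj x.
have /choice[u uP] : forall n, exists y, F y = periodize (window n x).
  move=> n; pose h (f : {ffun 'I_n.*2.+1 -> G}) := window n (F (periodize f)).
  have hE f : periodize (h f) = F (periodize f).
    by rewrite windowK// -GCA_shiftz// periodize_shift.
  have /injF_bij[g _ gK] : injective h.
    move=> f f' /(congr1 (@periodize n)); rewrite !hE => /Finj.
    exact: can_inj (@periodizeK n) _ _.
  by exists (periodize (g (window n x))); rewrite -hE gK.
have [y yu] := seq_adherent u; exists y.
suff /mulg1_eq : x^-1 * F y = 1 by rewrite invgK.
apply: cyl_eq1 => M; apply: (adherent_cyl (n := M) hF yu) => k Mk.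
rewrite uP; apply/cylP => i iM; rewrite periodize_window//.
exact: leq_trans Mk.
Qed.

(** If [Fi] were discontinuous at 1, some [u m] tending to 1 would have [Fi (u m)] outside a fixed
    cylinder; but [F] sends an adherent point of these images to 1, so that point is 1. *)
Lemma GCA_inverse F Fi :
  is_GCA F -> cancel F Fi -> cancel Fi F -> is_GCA Fi.
Proof.
move=> hF FK FiK.
apply: cyl_GCA.
- by move=> c d; apply: (can_inj FK); rewrite (GCA_morph hF) !FiK.
- by move=> c; apply: (can_inj FK); rewrite FiK (GCA_shift hF) FiK.
move=> M; apply: contrapT => /forallNP nM.
have {nM} /choice[u uP] : forall m, exists c, cyl m c /\ ~ cyl M (Fi c).
  by move=> m; have /existsNP[c /not_implyP] := nM m; exists c.
have [y yu] := seq_adherent (Fi \o u).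
suff y1 : y = 1.
  have [k _] := yu M 0; rewrite y1 invg1 mul1g.
  exact: (uP k).2.
apply: (can_inj FK); rewrite (GCA1 hF); apply: cyl_eq1 => n.
rewrite -[F y]mul1g; apply: (adherent_cyl (n := n) hF yu) => k nk.
rewrite mul1g /= FiK; exact: cylS nk (uP k).1.
Qed.

End Inverse.

(** * Stable and unstable groups of 1 *)

Section Dynamics.
Variable G : finGroupType.
Implicit Types (x y z : config G) (M N n m k : nat).
Implicit Types (F Fi : config G -> config G).

(** The local stable group of 1. Taken for [Fi] at the point [Fi y], it bounds the strict past of
    [y] and leaves time 0 free. *)
Definition forward_set N F : set (config G) :=
  [set x | forall n, cyl N (iter n F x)].

Definition stable_set F : set (config G) :=
  [set x | forall M, exists m, forall n, (m <= n)%N -> cyl M (iter n F x)].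

(** Symmetric in [F] and [Fi], so that results about the future also serve for the past. *)
Record expansive_pair N F Fi : Prop := {
  pair_GCA : is_GCA F;
  pair_GCAV : is_GCA Fi;
  pairK : cancel F Fi;
  pairVK : cancel Fi F;
  pair_expansive : forward_set N F `&` forward_set N Fi `<=` [set 1] }.

Lemma expansive_pairV N F Fi : expansive_pair N F Fi -> expansive_pair N Fi F.
Proof. by case=> *; split=> //; rewrite setIC. Qed.

Lemma iterK F Fi n : cancel F Fi -> cancel (iter n F) (iter n Fi).
Proof. by move=> FK; elim: n => // n IH x; rewrite iterSr /= FK IH. Qed.

Lemma iter_subK F Fi n k x : cancel F Fi -> (k <= n)%N ->
  iter k Fi (iter n F x) = iter (n - k) F x.
Proof. by move=> FK kn; rewrite -{1}(subnKC kn) iterD iterK. Qed.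

Lemma forward_setM N F x y : is_GCA F ->
  forward_set N F x -> forward_set N F y -> forward_set N F (x * y).
Proof.
by move=> hF xN yN n; rewrite (GCA_morph (GCA_iter n hF)); exact: cylM.
Qed.

Lemma forward_set_iter N F x k :
  forward_set N F x -> forward_set N F (iter k F x).
Proof. by move=> xN n; rewrite -iterD. Qed.

Lemma stable_setM F x y : is_GCA F ->
  stable_set F x -> stable_set F y -> stable_set F (x * y).
Proof.
move=> hF sx sy M; have [m hm] := sx M; have [k hk] := sy M.
exists (maxn m k) => n; rewrite geq_max => /andP[mn kn].
by rewrite (GCA_morph (GCA_iter n hF)); apply: cylM; [exact: hm|exact: hk].
Qed.

Lemma stable_setJ F x y : is_GCA F -> stable_set F x -> stable_set F (x ^ y).
Proof.
move=> hF sx M; have [m hm] := sx M; exists m => n mn.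
have hn := GCA_iter n hF.
by rewrite /conjg !(GCA_morph hn) (GCAV _ hn); exact/cylJ/hm.
Qed.

Lemma stable_set_shiftz F x (k : int) : is_GCA F ->
  stable_set F x -> stable_set F (shiftz k x).
Proof.
move=> hF sx M; have [m hm] := sx (M + `|k|)%N; exists m => n mn i iM.
rewrite (GCA_shiftz _ _ (GCA_iter n hF)); apply: hm => //; lia.
Qed.

Lemma stable_set_iterV F Fi x k : cancel Fi F ->
  stable_set F x -> stable_set F (iter k Fi x).
Proof.
move=> FiK sx M; have [m hm] := sx M; exists (m + k)%N => n mkn.
have kn : (k <= n)%N by apply: leq_trans mkn; exact: leq_addl.
by rewrite -(subnK kn) iterD iterK//; apply: hm; rewrite leq_subRL// addnC.
Qed.

(** Iterates violating the bound at later and later times would accumulate at a point whose whole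
    orbit lies in [cyl N], hence at 1, and so would enter [cyl M]. *)
Lemma forward_set_uniform N F Fi M : expansive_pair N F Fi ->
  exists m, forall n x, (m <= n)%N -> forward_set N F x -> cyl M (iter n F x).
Proof.
move=> h; apply: contrapT => /forallNP nM.
have {nM} /choice[u uP] : forall m, exists v : nat * config G,
    [/\ (m <= v.1)%N, forward_set N F v.2 & ~ cyl M (iter v.1 F v.2)].
  move=> m; have /existsNP[n /existsNP[x]] := nM m.
  by move=> /not_implyP[? /not_implyP[? ?]]; exists (n, x).
have [y yu] := seq_adherent (fun m => iter (u m).1 F (u m).2).
suff y1 : y = 1.
  have [k _] := yu M 0; rewrite y1 invg1 mul1g.
  by have [] := uP k.
apply: (pair_expansive h); split=> j; rewrite -[iter _ _ _]mul1g.
  apply: (adherent_cyl (n := 0) (GCA_iter j (pair_GCA h)) yu) => k _.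
  by rewrite mul1g -iterD; have [_ + _] := uP k; exact.
apply: (adherent_cyl (n := j) (GCA_iter j (pair_GCAV h)) yu) => k jk.
have [kv uN _] := uP k.
by rewrite mul1g (iter_subK _ (pairK h)); [exact: uN | exact: leq_trans kv].
Qed.

Lemma forward_set_stable N F Fi : expansive_pair N F Fi ->
  forward_set N F `<=` stable_set F.
Proof.
move=> h x xN M; have [m hm] := forward_set_uniform M h.
by exists m => n mn; exact: hm.
Qed.

(** An adherent point of counterexamples with ever longer pasts in [cyl N] would itself serve as [y]
    for one of them. *)
Lemma past_approx N F Fi : expansive_pair N F Fi ->
  exists n, forall x, (forall k, (0 < k <= n)%N -> cyl N (iter k Fi x)) ->
    exists2 y, forward_set N Fi (Fi y) & cyl N (y^-1 * x).
Proof.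
move=> h; apply: contrapT => /forallNP nP.
have {nP} /choice[u uP] : forall n, exists x,
    (forall k, (0 < k <= n)%N -> cyl N (iter k Fi x)) /\
    ~ exists2 y, forward_set N Fi (Fi y) & cyl N (y^-1 * x).
  by move=> n; have /existsNP[x /not_implyP] := nP n; exists x.
have [x xu] := seq_adherent u.
have [k _ xk] := xu N 0; apply: (uP k).2; exists x => // j.
rewrite -iterSr -[iter _ _ _]mul1g.
apply: (adherent_cyl (n := j.+1) (GCA_iter j.+1 (pair_GCAV h)) xu) => l jl.
by rewrite mul1g; apply: (uP l).1.
Qed.

(** [past_approx] controls [y^-1 * x] at time 0 only. Repeating it along the forward orbit corrects
    [y] up to any finite time, and compactness yields one [y] for all times. *)
Lemma splice N F Fi : expansive_pair N F Fi ->
  exists n, forall x, (forall k, (0 < k <= n)%N -> cyl N (iter k Fi x)) ->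
    exists2 y, forward_set N Fi (Fi y) & forward_set N F (y^-1 * x).
Proof.
move=> h; have [n hn] := past_approx h; exists n.
have hF := pair_GCA h; have hFi := pair_GCAV h.
have finite m : forall x, (forall k, (0 < k <= n)%N -> cyl N (iter k Fi x)) ->
    exists2 y, forward_set N Fi (Fi y) &
      forall j, (j < m)%N -> cyl N (iter j F (y^-1 * x)).
  elim: m => [|m IH] x xn.
    by have [y] := hn x xn; exists y.
  have [y yL yx] := hn x xn.
  (* The new point keeps its past in [cyl N]: one step back is [y^-1 * x] itself, and further back
     are products of the pasts of [y^-1] and [x]. *)
  have [k /andP[k0 kn]|z zL zx] := IH (F (y^-1 * x)).
    case: k k0 kn => // k _ kn; rewrite iterSr (pairK h).
    case: k kn => [|k] kn //; rewrite (GCA_morph (GCA_iter k.+1 hFi)).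
    apply: cylM; last by apply: xn; exact: ltnW.
    by rewrite (GCAV _ (GCA_iter k.+1 hFi)) iterSr; apply: cylV; exact: yL.
  exists (y * Fi z).
    rewrite (GCA_morph hFi); apply: forward_setM => //.
    exact: (forward_set_iter 1 zL).
  have yzx : (y * Fi z)^-1 * x = Fi (z^-1 * F (y^-1 * x)).
    by rewrite (GCA_morph hFi) (pairK h) (GCAV _ hFi) invgM mulgA.
  case=> [|j] jm; rewrite yzx.
    rewrite /= (GCA_morph hFi) (pairK h) (GCAV _ hFi).
    by apply: cylM => //; apply: cylV; exact: (zL 0).
  by rewrite iterSr (pairVK h); exact: zx.
move=> x xn; have /choice[u uP] : forall m, exists y, forward_set N Fi (Fi y) /\
    forall j, (j < m)%N -> cyl N (iter j F (y^-1 * x)).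
  by move=> m; have [y] := finite m x xn; exists y.
have [y yu] := seq_adherent u; exists y => j.
  rewrite -iterSr -[iter _ _ _]mul1g.
  apply: (adherent_cyl (n := 0) (GCA_iter j.+1 hFi) yu) => k _.
  by rewrite mul1g iterSr; exact: (uP k).1.
have hj := GCA_iter j hF.
(* [adherent_cyl] wants the limit point in the last factor, hence the inverse. *)
rewrite (GCA_morph hj) (GCAV _ hj) -[X in cyl _ X]invgK invgM invgK.
apply/cylV/(adherent_cyl (n := j.+1) hj yu) => k jk.
have := (uP k).2 j jk; rewrite (GCA_morph hj) (GCAV _ hj) => /cylV.
by rewrite invgM invgK.
Qed.

(* The product of the local unstable group and the stable group. *)
Definition local_product N F Fi : set (config G) :=
  [set x | exists2 y, forward_set N Fi (Fi y) & stable_set F (y^-1 * x)].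

Lemma GCA_iter_cyl F M n : is_GCA F ->
  exists m, forall k x, (k <= n)%N -> cyl m x -> cyl M (iter k F x).
Proof.
move=> hF; elim: n => [|n [m hm]].
  by exists M => k x; rewrite leqn0 => /eqP ->.
have [m' hm'] := GCA_cyl M (GCA_iter n.+1 hF); exists (maxn m m') => k x.
rewrite leq_eqVlt => /predU1P[->|kn] xm.
  by apply/hm'/cylS/xm; exact: leq_maxr.
by apply: hm => //; apply: cylS xm; exact: leq_maxl.
Qed.

Lemma local_product_cyl N F Fi : expansive_pair N F Fi ->
  exists m, forall x, cyl m x -> local_product N F Fi x.
Proof.
move=> h; have [n hn] := splice h.
have [m hm] := GCA_iter_cyl N n (pair_GCAV h); exists m => x xm.
have [|y yL yx] := hn x; first by move=> k /andP[_ kn]; exact: hm.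
by exists y => //; exact: forward_set_stable h _ yx.
Qed.

(** The conjugation is absorbed by a normal subgroup, so products with the stable group are closed
    under multiplication. *)
Lemma mul_twist x y a b :
  (a * b)^-1 * (x * y) = ((a^-1 * x) ^ b) * (b^-1 * y).
Proof. by rewrite /conjg invgM !mulgA mulgK. Qed.

Lemma local_productM N F Fi x y : expansive_pair N F Fi ->
  local_product N F Fi x -> local_product N F Fi y ->
  local_product N F Fi (x * y).
Proof.
move=> h [a aL ax] [b bL yb]; exists (a * b).
  by rewrite (GCA_morph (pair_GCAV h)); exact: (forward_setM (pair_GCAV h)).
rewrite mul_twist; apply: (stable_setM (pair_GCA h)) => //.
exact: (stable_setJ _ (pair_GCA h)).
Qed.

Lemma local_productV N F Fi x k : expansive_pair N F Fi ->
  local_product N F Fi x -> local_product N F Fi (iter k Fi x).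
Proof.
move=> h [y yL yx]; have hk := GCA_iter k (pair_GCAV h).
exists (iter k Fi y).
  by rewrite -iterS iterSr; exact: forward_set_iter.
by rewrite -(GCAV _ hk) -(GCA_morph hk); exact: stable_set_iterV (pairVK h) yx.
Qed.

Lemma stable_unstable N F Fi x : expansive_pair N F Fi ->
  exists2 y, stable_set Fi y & stable_set F (y^-1 * x).
Proof.
move=> h; have hF := pair_GCA h; have hFi := pair_GCAV h.
pose W x := exists2 y, stable_set Fi y & stable_set F (y^-1 * x).
have WM u v : W u -> W v -> W (u * v).
  move=> [a au ax] [b bu bx]; exists (a * b); first exact: stable_setM.
  by rewrite mul_twist; apply: stable_setM => //; exact: stable_setJ.
have Wsh (k : int) u : W u -> W (shiftz k u).
  move=> [a au ax]; exists (shiftz k a); first exact: stable_set_shiftz.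
  exact: stable_set_shiftz _ _ hF ax.
have [m hm] := local_product_cyl h.
have Wcyl u : cyl m u -> W u.
  move=> /hm[a /(forward_set_stable (expansive_pairV h)) au ax]; exists a => //.
  by rewrite -(pairVK h a); exact: (@stable_set_iterV Fi F _ 1%N (pairK h) au).
(* [u] is trivial to the right of 0 and [v] to the left, so a translate of each
   lies in the cylinder [cyl m]. *)
pose u : config G := fun i => if (i <= 0)%R then x i else 1.
pose v : config G := fun i => if (i <= 0)%R then 1 else x i.
have -> : x = u * v.
  apply/funext => i; rewrite [RHS](_ : _ = (u i : G) * (v i : G))// /u /v.
  by case: ifP; rewrite ?mulg1 ?mul1g.
apply: WM.
  rewrite -(shiftzK (Posz m.+1) u); apply: Wsh; apply: Wcyl => i im.
  by rewrite /shiftz /u ifF//; lia.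
rewrite -(shiftzNK (Posz m) v); apply: Wsh; apply: Wcyl => i im.
by rewrite /shiftz /v ifT//; lia.
Qed.

Lemma local_productT N F Fi x : expansive_pair N F Fi -> local_product N F Fi x.
Proof.
move=> h; have hFi := pair_GCAV h; set P := local_product N F Fi.
(* Far enough back, the unstable factor of [y] becomes local, while the stable factor stays
   stable. *)
have reach y : exists k, P (iter k Fi y).
  have [a au ay] := stable_unstable y h; have [k hk] := au N; exists k.
  have hk' := GCA_iter k hFi; exists (iter k Fi a).
    by rewrite -iterS => n; rewrite -iterD; apply: hk; lia.
  rewrite -(GCAV _ hk') -(GCA_morph hk').
  exact: stable_set_iterV (pairVK h) ay.
suff [k hk] : exists k, forall y, P (iter k Fi y).
  by rewrite -(iterK k (pairK h) x); exact: hk.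
apply: contrapT => /forallNP nP.
have {nP} /choice[u uP] : forall k, exists y, ~ P (iter k Fi y).
  by move=> k; have /existsNP[y] := nP k; exists y.
have [y yu] := seq_adherent u; have [j yj] := reach y.
have [m hm] := local_product_cyl h.
have hj := GCA_iter j hFi; have [m' hm'] := GCA_cyl m hj.
(* For [u k] close to [y], the [j]-th preimages differ by an element of a cylinder inside [P];
   invariance of [P] under [Fi] then leads from [j] to [k]. *)
have [k jk /hm'/hm] := yu m' j; rewrite (GCA_morph hj) (GCAV _ hj).
move=> /(local_productM h yj); rewrite mulVKg => /(local_productV (k - j) h).
by rewrite -iterD subnK//; exact: uP.
Qed.

Lemma stable_set_dense N F Fi x M : expansive_pair N F Fi ->
  exists2 y, stable_set F y & cyl M (x^-1 * y).
Proof.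
move=> h; have [m hm] := forward_set_uniform M (expansive_pairV h).
(* One step more than [m], because the bound on [a] starts only at [Fi a]. *)
have hm' := GCA_iter m.+1 (pair_GCAV h).
have [a aL ax] := local_productT (iter m.+1 F x) h.
exists ((iter m.+1 Fi a)^-1 * x).
  have := @stable_set_iterV F Fi _ m.+1 (pairVK h) ax.
  by rewrite (GCA_morph hm') (GCAV _ hm') iterK//; exact: pairK h.
by apply: (@cylJ _ M _ x); apply: cylV; rewrite iterSr; exact: hm.
Qed.

Lemma expansive_pair_transitive N F Fi :
  expansive_pair N F Fi -> topologically_transitive F.
Proof.
move=> h U V oU [p Up] oV [q Vq].
have [M hM] := cyl_nbhs (open_nbhs_nbhs (conj oU Up)).
have [K hK] := cyl_nbhs (open_nbhs_nbhs (conj oV Vq)).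
have [p' sp pp'] := stable_set_dense p M h.
have [q' uq qq'] := stable_set_dense q K (expansive_pairV h).
have [m hm] := sp K; have [k hk] := uq M; pose n := maxn m k.
exists n, (iter n F (p' * iter n Fi q')); split.
  exists (p' * iter n Fi q') => //; apply: hM; rewrite mulgA.
  by apply: cylM => //; apply: hk; exact: leq_maxr.
apply: hK; rewrite (GCA_morph (GCA_iter n (pair_GCA h))) (iterK _ (pairVK h)).
(* Conjugation by [q] frees the stable error from between [q^-1] and [q'] and preserves
   cylinders. *)
have -> (c : config G) : q^-1 * (c * q') = (c ^ q) * (q^-1 * q').
  by rewrite /conjg !mulgA mulgK.
by apply: cylM => //; apply/cylJ/hm; exact: leq_maxl.
Qed.

End Dynamics.

(** * From metric expansivity to cylinders *)

Local Open Scope ring_scope.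

Lemma config_dist_cyl (R : realType) (G : finGroupType) (N : nat)
    (c : config G) : cyl N c -> config_dist R c 1%g <= 2 ^- N.
Proof.
move=> cN; rewrite /config_dist; case: pselect => [_|c1].
  by rewrite invr_ge0 exprn_ge0.
case: ex_minnP => m /asboolP[j jm cj] _; rewrite lef_pV2 ?posrE ?exprn_gt0//.
rewrite ler_eXn2l// ?ltr1n//; rewrite leqNgt; apply/negP => mN; apply: cj.
by apply: cN; rewrite jm ltnW.
Qed.

Lemma expansive_expansive_pair (R : realType) (G : finGroupType)
    (F : config G -> config G) : is_GCA F -> injective F -> expansive R F ->
  exists N, expansive_pair N F ('pinv_id [set: config G] F).
Proof.
set Fi := 'pinv_id [set: config G] F => hF Finj [eps eps0 Fexp].
have FK : cancel F Fi.
  by move=> x; apply: pinvKV; rewrite ?inE// => y z _ _ /Finj.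
have FiK : cancel Fi F.
  move=> x; apply: pinvK; rewrite inE /=.
  by have [y <-] := GCA_surj hF Finj x; exists y.
have hFi := GCA_inverse hF FK FiK.
(* With [2 ^- N < eps], an orbit staying in [cyl N] is never separated from the fixed point 1. *)
have [N _ /(_ N (leqnn N)) /= hN] := near_infty_natSinv_expn_lt (PosNum eps0).
exists N; split=> // x [xF xFi]; apply: contrapT => x1.
have [n] := Fexp x 1%g x1; apply/negP; rewrite -leNgt.
have -> : iterz F n 1%g = 1%g :> config G.
  case: n => n; first exact: GCA1 (GCA_iter n hF).
  exact: GCA1 (GCA_iter n.+1 hFi).
apply: le_trans (config_dist_cyl R (N := N) _) (ltW _).
  by case: n => n; [exact: xF|exact: xFi n.+1].
by rewrite -div1r.
Qed.

Theorem theorem6 (R : realType) (G : finGroupType) (F : config G -> config G)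
    (F_gca : is_GCA F) (F_inj : injective F) (F_exp : expansive R F) :
  topologically_transitive F.
Proof.
have [N] := expansive_expansive_pair F_gca F_inj F_exp.
exact: expansive_pair_transitive.
Qed.
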